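(* Let $n\ge1$. The logic $\mathrm{BD}_n$ (respectively $\mathrm{LP}_n$, $\mathrm{K}_n$, $\mathrm{CL}_n$) is complete with respect to the structure $\boldsymbol{\mathcal{DM}}_n$ (respectively $\boldsymbol{\mathcal{P}}_n$, $\boldsymbol{\mathcal{K}}_n$, $\boldsymbol{\mathcal{B}}_n$), i.e. $\Gamma\vdash\varphi$ holds in the logic iff it is valid in that structure. The logic $\mathrm{KO}_n$ is complete with respect to the family of structures $\boldsymbol{\mathcal{P}}_i\otimes\boldsymbol{\mathcal{K}}_j$ with $i+j=n$, $0\le i,j\le n$.
   Context: Formulas are built from variables using $\wedge,\vee,\neg$. A structure is a pair $\langle\mathbf{A},F\rangle$ with $\mathbf{A}$ an algebra of this signature and $F\subseteq A$; a rule $\Gamma\vdash\varphi$ is valid in it if every homomorphism $v$ from the formula algebra to $\mathbf{A}$ with $v[\Gamma]\subseteq F$ has $v(\varphi)\in F$. A logic is a substitution-invariant consequence relation; the extension of a logic by a set of rules is the smallest logic containing it and those rules. $\mathrm{BD}_\infty$ is the logic determined by all structures $\langle\mathbf{A},F\rangle$ with $\mathbf{A}$ a De~Morgan lattice (distributive lattice with $\neg$ satisfying $\neg\neg x=x$ and De~Morgan laws) and $F$ an upset. $\mathrm{LP}_\infty$: extension of $\mathrm{BD}_\infty$ by $\emptyset\vdash x\vee\neg x$ and $x\vdash x\wedge(y\vee\neg y)$; $\mathrm{K}_\infty$: by $(x\wedge\neg x)\vee y\vdash y$; $\mathrm{CL}_\infty$: by all three; $\mathrm{KO}_\infty$: by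 $((x\wedge\neg x)\wedge z)\vee u\vdash((y\vee\neg y)\wedge z)\vee u$. $\mathrm{BD}_n,\mathrm{LP}_n,\mathrm{K}_n,\mathrm{KO}_n,\mathrm{CL}_n$ are the extensions of these by the $n$-adjunction rule $\{\bigwedge_{j\ne i}x_j : 1\le i\le n+1\}\vdash x_1\wedge\dots\wedge x_{n+1}$. $\mathbf{DM}_1$: four-element De~Morgan lattice on $\{\mathsf f,\mathsf n,\mathsf b,\mathsf t\}$, $\mathsf f<\mathsf n,\mathsf b<\mathsf t$, $\mathsf n,\mathsf b$ incomparable, $\neg\mathsf t=\mathsf f$, $\neg\mathsf n=\mathsf n$, $\neg\mathsf b=\mathsf b$. $\boldsymbol{\mathcal{DM}}_1=\langle\mathbf{DM}_1,\{\mathsf t,\mathsf b\}\rangle$; $\boldsymbol{\mathcal{P}}_1,\boldsymbol{\mathcal{K}}_1,\boldsymbol{\mathcal{B}}_1$ are its substructures on $\{\mathsf t,\mathsf b,\mathsf f\}$, $\{\mathsf t,\mathsf n,\mathsf f\}$, $\{\mathsf t,\mathsf f\}$ with designated sets $\{\mathsf t,\mathsf b\},\{\mathsf t\},\{\mathsf t\}$. The dual product of $\langle\mathbf{A}_k,F_k\rangle$ is $\langle\prod\mathbf{A}_k,\bigcup_k\pi_k^{-1}[F_k]\rangle$; $\boldsymbol{\mathcal{DM}}_n,\boldsymbol{\mathcal{P}}_n,\boldsymbol{\mathcal{K}}_n,\boldsymbol{\mathcal{B}}_n$ are the $n$-fold dual powers of $\boldsymbol{\mathcal{DM}}_1,\boldsymbol{\mathcal{P}}_1,\boldsymbol{\mathcal{K}}_1,\boldsymbol{\mathcal{B}}_1$,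 and $\boldsymbol{\mathcal{P}}_i\otimes\boldsymbol{\mathcal{K}}_j$ is the dual product of $i$ copies of $\boldsymbol{\mathcal{P}}_1$ and $j$ copies of $\boldsymbol{\mathcal{K}}_1$. *)

(* Defs.v *)
From mathcomp Require Import ssreflect ssrfun ssrbool eqtype ssrnat seq fintype.
From mathcomp Require Import boolp classical_sets.

Set Implicit Arguments.
Unset Strict Implicit.
Unset Printing Implicit Defensive.

Local Open Scope classical_set_scope.

Record algebra := Algebra {
  carrier :> Type;
  meet : carrier -> carrier -> carrier;
  join : carrier -> carrier -> carrier;
  neg : carrier -> carrier
}.

Arguments meet {_} _ _.
Arguments join {_} _ _.
Arguments neg {_} _.

Record structure := Structure {
  alg :> algebra;
  designated : set alg
}.

Arguments designated : clear implicits.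

Record is_hom (A B : algebra) (f : A -> B) : Prop := IsHom {
  hom_meet : forall x y, f (meet x y) = meet (f x) (f y);
  hom_join : forall x y, f (join x y) = join (f x) (f y);
  hom_neg : forall x, f (neg x) = neg (f x)
}.

Record de_morgan_lattice (A : algebra) : Prop := DeMorganLattice {
  dml_meetA : forall x y z : A, meet x (meet y z) = meet (meet x y) z;
  dml_joinA : forall x y z : A, join x (join y z) = join (join x y) z;
  dml_meetC : forall x y : A, meet x y = meet y x;
  dml_joinC : forall x y : A, join x y = join y x;
  dml_meetK : forall x y : A, meet x (join x y) = x;
  dml_joinK : forall x y : A, join x (meet x y) = x;
  dml_meet_joinr : forall x y z : A,
    meet x (join y z) = join (meet x y) (meet x z);
  dml_negK : forall x : A, neg (neg x) = x;
  dml_neg_meet : forall x y : A, neg (meet x y) = join (neg x) (neg y);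
  dml_neg_join : forall x y : A, neg (join x y) = meet (neg x) (neg y)
}.

Definition lat_le (A : algebra) (x y : A) : Prop := meet x y = x.

Definition upset (A : algebra) (F : set A) : Prop :=
  forall x y : A, F x -> lat_le x y -> F y.

Inductive formula : Type :=
  | Var of nat
  | And of formula & formula
  | Or of formula & formula
  | Not of formula.

Definition formula_algebra : algebra := Algebra And Or Not.

Definition valid (M : structure) (G : set formula) (p : formula) : Prop :=
  forall v : formula -> M, is_hom (A := formula_algebra) v ->
    v @` G `<=` designated M -> designated M (v p).

Definition conseq : Type := set formula -> formula -> Prop.

Record is_logic (L : conseq) : Prop := IsLogic {
  logic_refl : forall (G : set formula) p, G p -> L G p;
  logic_mono : forall (G D : set formula) p, G `<=` D -> L G p -> L D p;
  logic_cut : forall (G D : set formula) p,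
    (forall q, D q -> L G q) -> L (G `|` D) p -> L G p;
  logic_subst : forall (s : formula -> formula) (G : set formula) p,
    is_hom (A := formula_algebra) (B := formula_algebra) s ->
    L G p -> L (s @` G) (s p)
}.

Definition logic_of (K : structure -> Prop) : conseq :=
  fun G p => forall M, K M -> valid M G p.

Definition rule : Type := set formula * formula.

(* The intersection of all logics containing [L] and [R], which is the
   smallest such logic. *)
Definition extension (L : conseq) (R : set rule) : conseq :=
  fun G p => forall L' : conseq, is_logic L' ->
    (forall D q, L D q -> L' D q) ->
    (forall r, R r -> L' r.1 r.2) ->
    L' G p.

Definition BD_infty : conseq :=
  logic_of (fun M => de_morgan_lattice M /\ upset (designated M)).

Section Rules.
Let x := Var 0.
Let y := Var 1.
Let z := Var 2.
Let u := Var 3.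

Definition lem_rule : rule := (set0, Or x (Not x)).

Definition lem_adj_rule : rule := ([set x], And x (Or y (Not y))).

Definition efq_rule : rule := ([set Or (And x (Not x)) y], y).

Definition ko_rule : rule :=
  ([set Or (And (And x (Not x)) z) u], Or (And (Or y (Not y)) z) u).
End Rules.

Definition LP_infty : conseq :=
  extension BD_infty [set lem_rule; lem_adj_rule].
Definition K_infty : conseq := extension BD_infty [set efq_rule].
Definition CL_infty : conseq :=
  extension BD_infty [set lem_rule; lem_adj_rule; efq_rule].
Definition KO_infty : conseq := extension BD_infty [set ko_rule].

(* Left-nested conjunction; the value on [::] is a dummy, never reached in
   [adj_rule n] for n >= 1. *)
Definition bigAnd (s : seq formula) : formula :=
  if s is p :: s' then foldl And p s' else Var 0.

(* The variables x_1, ..., x_{n+1} are [Var 0], ..., [Var n]. *)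
Definition adj_rule (n : nat) : rule :=
  ([set bigAnd [seq Var j | j <- iota 0 n.+1 & j != i] | i in [set i | i < n.+1]],
   bigAnd [seq Var j | j <- iota 0 n.+1]).

Definition BD (n : nat) : conseq := extension BD_infty [set adj_rule n].
Definition LP (n : nat) : conseq := extension LP_infty [set adj_rule n].
Definition K (n : nat) : conseq := extension K_infty [set adj_rule n].
Definition CL (n : nat) : conseq := extension CL_infty [set adj_rule n].
Definition KO (n : nat) : conseq := extension KO_infty [set adj_rule n].

Inductive four : Type := vf | vn | vb | vt.

Definition meet4 (x y : four) : four :=
  match x, y with
  | vt, w | w, vt => w
  | vn, vn => vn
  | vb, vb => vb
  | _, _ => vf
  end.

Definition join4 (x y : four) : four :=
  match x, y with
  | vf, w | w, vf => w
  | vn, vn => vn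
  | vb, vb => vb
  | _, _ => vt
  end.

Definition neg4 (x : four) : four :=
  match x with vf => vt | vn => vn | vb => vb | vt => vf end.

Definition DM1 : structure :=
  @Structure (Algebra meet4 join4 neg4) [set vt; vb].

Section Substructure.
Variables (M : structure) (S : M -> bool).
Hypothesis S_meet : forall x y, S x -> S y -> S (meet x y).
Hypothesis S_join : forall x y, S x -> S y -> S (join x y).
Hypothesis S_neg : forall x, S x -> S (neg x).

Definition sub_algebra : algebra := @Algebra {x : M | S x}
  (fun x y => exist (fun w => S w) _ (S_meet (svalP x) (svalP y)))
  (fun x y => exist (fun w => S w) _ (S_join (svalP x) (svalP y)))
  (fun x => exist (fun w => S w) _ (S_neg (svalP x))).

Definition substructure : structure :=
  @Structure sub_algebra [set x : sub_algebra | designated M (sval x)].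
End Substructure.

Definition in_P (x : four) : bool := if x is vn then false else true.
Definition in_K (x : four) : bool := if x is vb then false else true.
Definition in_B (x : four) : bool := in_P x && in_K x.

Lemma in_P_meet x y : in_P x -> in_P y -> in_P (meet4 x y).
Proof. by case: x; case: y. Qed.
Lemma in_P_join x y : in_P x -> in_P y -> in_P (join4 x y).
Proof. by case: x; case: y. Qed.
Lemma in_P_neg x : in_P x -> in_P (neg4 x).
Proof. by case: x. Qed.
Lemma in_K_meet x y : in_K x -> in_K y -> in_K (meet4 x y).
Proof. by case: x; case: y. Qed.
Lemma in_K_join x y : in_K x -> in_K y -> in_K (join4 x y).
Proof. by case: x; case: y. Qed.
Lemma in_K_neg x : in_K x -> in_K (neg4 x).
Proof. by case: x. Qed.
Lemma in_B_meet x y : in_B x -> in_B y -> in_B (meet4 x y).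
Proof. by case: x; case: y. Qed.
Lemma in_B_join x y : in_B x -> in_B y -> in_B (join4 x y).
Proof. by case: x; case: y. Qed.
Lemma in_B_neg x : in_B x -> in_B (neg4 x).
Proof. by case: x. Qed.

Definition P1 : structure :=
  @substructure DM1 in_P in_P_meet in_P_join in_P_neg.
Definition K1 : structure :=
  @substructure DM1 in_K in_K_meet in_K_join in_K_neg.
Definition B1 : structure :=
  @substructure DM1 in_B in_B_meet in_B_join in_B_neg.

Definition prod_algebra (I : Type) (A : I -> algebra) : algebra :=
  @Algebra (forall k, A k)
    (fun a b k => meet (a k) (b k))
    (fun a b k => join (a k) (b k))
    (fun a k => neg (a k)).

Definition dual_product (I : Type) (M : I -> structure) : structure :=
  @Structure (prod_algebra M)
    (\bigcup_k [set a : prod_algebra M | designated (M k) (a k)]).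

Definition dual_power (M : structure) (n : nat) : structure :=
  dual_product (fun _ : 'I_n => M).

Definition DMn (n : nat) : structure := dual_power DM1 n.
Definition Pn (n : nat) : structure := dual_power P1 n.
Definition Kn (n : nat) : structure := dual_power K1 n.
Definition Bn (n : nat) : structure := dual_power B1 n.

Definition PK (i j : nat) : structure :=
  dual_product (fun k : 'I_i + 'I_j => if k is inl _ then P1 else K1).

(* Main.v *)
Require Import Defs.
From mathcomp Require Import ssreflect ssrfun ssrbool eqtype ssrnat seq fintype.
From mathcomp Require Import boolp classical_sets.

(** Let [T] be the set of consequences of [G] in the logic and [p] outside [T].
    Every rule in play survives adding a side disjunct, so a theory [F]
    containing [T] and maximal among those avoiding [p] is prime: consider
    [{q | q \/ r in F}].  The maximal filters contained in [F] are prime and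
    cover [F], and [n]-adjunction allows at most [n] of them.  A prime filter
    [Q] on formulas is a valuation into the four-element structure (the value
    of [q] records whether [q] and [~ q] lie in [Q]), and the additional rules
    confine it to the relevant substructure; together these filters form the
    countermodel in the dual product.  Soundness of [n]-adjunction in a dual
    product of [n] factors is the pigeonhole principle. *)

Set Implicit Arguments.
Unset Strict Implicit.
Unset Printing Implicit Defensive.

Local Open Scope classical_set_scope.

(** * Order of the free De Morgan lattice *)

(** Quantifying over all De Morgan lattices lets each inequality be read off the lattice laws;
    [logic_up] later turns it into consequence. *)
Definition fle (p q : formula) : Prop :=
  forall (A : algebra) (v : formula -> A), de_morgan_lattice A ->
    is_hom (A := formula_algebra) v -> lat_le (v p) (v q).

Lemma formula_homE (A : algebra) (v : formula -> A) :
  is_hom (A := formula_algebra) v ->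
  ((forall p q, v (And p q) = meet (v p) (v q)) *
   (forall p q, v (Or p q) = join (v p) (v q)) *
   (forall p, v (Not p) = neg (v p)))%type.
Proof. by move=> [hI hU hN]; split; [split|]. Qed.

Section LatticeOrder.
Variables (A : algebra) (dm : de_morgan_lattice A).
Implicit Types x y z : A.

Lemma lat_meetxx x : meet x x = x.
Proof. by rewrite -{2}(dml_joinK dm x x) (dml_meetK dm). Qed.

Lemma lat_le_trans x y z : lat_le x y -> lat_le y z -> lat_le x z.
Proof. by rewrite /lat_le => xy yz; rewrite -xy -(dml_meetA dm) yz. Qed.

Lemma lat_leIl x y : lat_le (meet x y) x.
Proof.
by rewrite /lat_le (dml_meetC dm x y) -(dml_meetA dm) lat_meetxx.
Qed.

Lemma lat_leI z x y : lat_le z x -> lat_le z y -> lat_le z (meet x y).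
Proof. by rewrite /lat_le => zx zy; rewrite (dml_meetA dm) zx zy. Qed.

Lemma lat_leUl x y : lat_le x (join x y).
Proof. exact: dml_meetK dm x y. Qed.

Lemma lat_leU x y z : lat_le x z -> lat_le y z -> lat_le (join x y) z.
Proof.
rewrite /lat_le => xz yz.
by rewrite (dml_meetC dm) (dml_meet_joinr dm) !(dml_meetC dm z) xz yz.
Qed.

End LatticeOrder.

Lemma fle_refl p : fle p p.
Proof. by move=> A v dm _; exact: lat_meetxx. Qed.

Lemma fle_trans q p r : fle p q -> fle q r -> fle p r.
Proof.
by move=> pq qr A v dm h; apply: (lat_le_trans dm (pq A v dm h)); exact: qr.
Qed.

Lemma fle_andl p q : fle (And p q) p.
Proof. by move=> A v dm h; rewrite (formula_homE h); exact: lat_leIl. Qed.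

Lemma fle_andr p q : fle (And p q) q.
Proof.
by move=> A v dm h; rewrite (formula_homE h) (dml_meetC dm); exact: lat_leIl.
Qed.

Lemma fle_and r p q : fle r p -> fle r q -> fle r (And p q).
Proof.
move=> rp rq A v dm h; rewrite (formula_homE h).
by apply: (lat_leI dm); [exact: rp|exact: rq].
Qed.

Lemma fle_orl p q : fle p (Or p q).
Proof. by move=> A v dm h; rewrite (formula_homE h); exact: lat_leUl. Qed.

Lemma fle_orr p q : fle q (Or p q).
Proof.
by move=> A v dm h; rewrite (formula_homE h) (dml_joinC dm); exact: lat_leUl.
Qed.

Lemma fle_or r p q : fle p r -> fle q r -> fle (Or p q) r.
Proof.
move=> pr qr A v dm h; rewrite (formula_homE h).
by apply: (lat_leU dm); [exact: pr|exact: qr].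
Qed.

Lemma fle_distr p q r : fle (And p (Or q r)) (Or (And p q) (And p r)).
Proof.
move=> A v dm h; rewrite !(formula_homE h) (dml_meet_joinr dm).
exact: lat_meetxx.
Qed.

Lemma fle_notnot p : fle (Not (Not p)) p /\ fle p (Not (Not p)).
Proof.
by split=> A v dm h; rewrite !(formula_homE h) (dml_negK dm); exact: lat_meetxx.
Qed.

Lemma fle_notand p q : fle (Not (And p q)) (Or (Not p) (Not q)) /\
  fle (Or (Not p) (Not q)) (Not (And p q)).
Proof.
by split=> A v dm h; rewrite !(formula_homE h) (dml_neg_meet dm);
  exact: lat_meetxx.
Qed.

Lemma fle_notor p q : fle (Not (Or p q)) (And (Not p) (Not q)) /\
  fle (And (Not p) (Not q)) (Not (Or p q)).
Proof.
by split=> A v dm h; rewrite !(formula_homE h) (dml_neg_join dm);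
  exact: lat_meetxx.
Qed.

Lemma fle_andS p p' q q' : fle p p' -> fle q q' -> fle (And p q) (And p' q').
Proof.
move=> h h'; apply: fle_and.
  by apply: fle_trans h; exact: fle_andl.
by apply: fle_trans h'; exact: fle_andr.
Qed.

Lemma fle_orS p p' q q' : fle p p' -> fle q q' -> fle (Or p q) (Or p' q').
Proof.
move=> h h'; apply: fle_or.
  by apply: (fle_trans h); exact: fle_orl.
by apply: (fle_trans h'); exact: fle_orr.
Qed.

Lemma fle_andC p q : fle (And p q) (And q p).
Proof. by apply: fle_and; [exact: fle_andr|exact: fle_andl]. Qed.

Lemma fle_orC p q : fle (Or p q) (Or q p).
Proof. by apply: fle_or; [exact: fle_orr|exact: fle_orl]. Qed.

Lemma fle_orA p q r : fle (Or p (Or q r)) (Or (Or p q) r) /\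
  fle (Or (Or p q) r) (Or p (Or q r)).
Proof.
split; repeat apply: fle_or; do ?[exact: fle_orl|exact: fle_orr].
- by apply: fle_trans (fle_orl _ _); exact: fle_orl.
- by apply: fle_trans (fle_orl _ _); exact: fle_orr.
- by apply: fle_trans (fle_orr _ _); exact: fle_orl.
- by apply: fle_trans (fle_orr _ _); exact: fle_orr.
Qed.

(** Distributivity in the form that factors a common side disjunct out of a conjunction. *)
Lemma fle_orI p q r : fle (And (Or p r) (Or q r)) (Or (And p q) r).
Proof.
apply: (fle_trans (fle_distr _ _ _)); apply: fle_or; last first.
  by apply: fle_trans (fle_orr _ _); exact: fle_andr.
apply: (fle_trans (fle_andC _ _)); apply: (fle_trans (fle_distr _ _ _)).
apply: fle_orS; first exact: fle_andC.
exact: fle_andr.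
Qed.

(** * Theories as sets of formulas *)

Implicit Types (F Q T X : set formula) (p q r : formula).

Definition up F := forall p q, fle p q -> F p -> F q.
Definition meet_closed F := forall p q, F p -> F q -> F (And p q).
Definition prime F := forall p q, F (Or p q) -> F p \/ F q.

(** Mapping [Var] over this list gives the [i]-th premise of [adj_rule n] up to conversion. *)
Definition others (n i : nat) : seq nat := [seq j <- iota 0 n.+1 | j != i].

Lemma mem_others n i j : (j \in others n i) = (j != i) && (j < n.+1).
Proof. by rewrite mem_filter mem_iota. Qed.

Lemma others_neq0 n i : 0 < n -> others n i != [::].
Proof.
move=> n0; apply/eqP => e.
(* The boolean [i == 0], read as a number, is an index below [n.+1] that differs from [i]. *)
have := mem_others n i (i == 0); rewrite e in_nil.
by case: i e => [|i] _ /=; rewrite ?ltnS // n0.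
Qed.

Definition adj_closed n F := forall f : nat -> formula,
  (forall i, i < n.+1 -> F (bigAnd [seq f j | j <- others n i])) ->
  F (bigAnd [seq f j | j <- iota 0 n.+1]).

Definition lem_closed F := forall p, F (Or p (Not p)).
Definition lem_adj_closed F := forall p q, F p -> F (And p (Or q (Not q))).
Definition efq_closed F := forall p q, F (Or (And p (Not p)) q) -> F q.
Definition ko_closed F := forall p q r u,
  F (Or (And (And p (Not p)) r) u) -> F (Or (And (Or q (Not q)) r) u).

(** Stated for any [Q] that splits conjunctions, so as to apply to principal filters [fle p], to
    maximal filters and to valuations alike. *)
Lemma bigAnd_mem Q (f : nat -> formula) (l : seq nat) :
  (forall p q, Q (And p q) <-> Q p /\ Q q) -> l != [::] ->
  Q (bigAnd [seq f j | j <- l]) <-> (forall j, j \in l -> Q (f j)).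
Proof.
move=> QI; case: l => //= a l _.
have : forall p, Q (foldl And p [seq f j | j <- l]) <->
    Q p /\ (forall j, j \in l -> Q (f j)).
  elim: l => [|b l IH] p /=; first by split=> [|[]].
  split.
    move/IH => [/QI[Qp Qb] H]; split=> // j.
    by rewrite inE => /orP[/eqP->|/H].
  move=> [Qp H]; apply/IH; split.
    by apply/QI; split=> //; apply: H; rewrite mem_head.
  by move=> j jl; apply: H; rewrite inE jl orbT.
move=> ->; split.
  by move=> [Qa H] j; rewrite inE => /orP[/eqP->|/H].
move=> H; split; first by apply: H; rewrite mem_head.
by move=> j jl; apply: H; rewrite inE jl orbT.
Qed.

Lemma fle_bigAnd p (f : nat -> formula) l : l != [::] ->
  fle p (bigAnd [seq f j | j <- l]) <-> (forall j, j \in l -> fle p (f j)).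
Proof.
apply: (bigAnd_mem (Q := fle p)) => q r; split; last by case; exact: fle_and.
by move=> h; split; apply: (fle_trans h); [exact: fle_andl|exact: fle_andr].
Qed.

Lemma fle_bigAndU (f : nat -> formula) p l : l != [::] ->
  fle (bigAnd [seq Or (f j) p | j <- l]) (Or (bigAnd [seq f j | j <- l]) p).
Proof.
case: l => //= a l _.
(* The two folds have different accumulators [q'] and [q]; the induction carries the invariant
   [fle q' (Or q p)]. *)
have : fle (Or (f a) p) (Or (f a) p) by exact: fle_refl.
move: {1 3}(Or (f a) p) => q'; move: (f a) => q; elim: l q' q => //= b l IH q' q h.
apply: IH; apply: fle_trans (fle_orI _ _ _).
by apply: fle_andS => //; exact: fle_refl.
Qed.

(** The head of the list is the innermost disjunct, so inductions on the tail peel off the second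
    entry. *)
Definition bigOr (s : seq formula) : formula :=
  if s is p :: s' then foldr Or p s' else Var 0.

Lemma fle_bigOr (f : nat -> formula) l j : j \in l ->
  fle (f j) (bigOr [seq f i | i <- l]).
Proof.
case: l => //= a l; elim: l => [|b l IH] /=.
  by rewrite inE => /eqP->; exact: fle_refl.
rewrite !inE orbCA => /orP[/eqP->|h]; first exact: fle_orl.
by apply: fle_trans (fle_orr _ _); apply: IH; rewrite inE.
Qed.

Lemma prime_bigOr Q (f : nat -> formula) l : prime Q -> l != [::] ->
  Q (bigOr [seq f i | i <- l]) -> exists2 j, j \in l & Q (f j).
Proof.
move=> Qpr; case: l => //= a l _; elim: l => [|b l IH] /=.
  by exists a => //; rewrite mem_head.
case/Qpr => [h|/IH[j jl Qj]]; first by exists b => //; rewrite !inE eqxx orbT.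
by exists j => //; move: jl; rewrite !inE orbCA => ->; rewrite orbT.
Qed.

(** * Prime theories *)

(** [Zorn_bigcup] is applied to the sets whose union with [X0] satisfies [P]; the empty chain is
    then covered by [P X0]. *)
Lemma Zorn_above (P : set (set formula)) X0 : P X0 ->
  (forall C : set (set formula), C !=set0 -> C `<=` P -> total_on C subset ->
     P (\bigcup_(X in C) X)) ->
  exists M, [/\ X0 `<=` M, P M & forall X, M `<=` X -> P X -> X `<=` M].
Proof.
move=> P0 Pch.
have [C CP Ctot|A [PA Amax]] := @Zorn_bigcup _ [set X | P (X0 `|` X)].
  have [C0|/set0P C0] := eqVneq C set0.
    by rewrite C0 /= bigcup_set0 setU0.
  rewrite /= (_ : _ `|` _ = \bigcup_(X in [set X0 `|` Y | Y in C]) X).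
    apply: Pch; first by case: C0 => Y CY; exists (X0 `|` Y), Y.
      by move=> _ [Y CY <-]; exact: CP.
    move=> _ _ [Y CY <-] [Z CZ <-].
    by have [h|h] := Ctot _ _ CY CZ; [left|right]; exact: setUS.
  apply/seteqP; split=> [q [q0|[Y CY Yq]]|q [_ [Y CY <-]] [q0|Yq]].
  - by case: C0 => Y CY; exists (X0 `|` Y); [exists Y|left].
  - by exists (X0 `|` Y); [exists Y|right].
  - by left.
  - by right; exists Y.
exists (X0 `|` A); split; [exact: subsetUl|exact: PA|].
move=> X sX PX q Xq.
apply: contrapT => nq; apply: (Amax X).
  rewrite properEneq; split; last by move=> z Az; apply: sX; right.
  by apply/eqP => e; apply: nq; right; rewrite e.
rewrite /= (_ : X0 `|` X = X) //; apply/setUidPr => z z0.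
by apply: sX; left.
Qed.

Definition residual F p : set formula := [set q | F (Or q p)].

(* [E] stands for the family of sets closed under the rules of a logic. *)
Record admissible (E : set (set formula)) : Prop := Admissible {
  adm_chain : forall C : set (set formula), C !=set0 -> C `<=` E ->
    total_on C subset -> E (\bigcup_(X in C) X);
  adm_residual : forall F p, up F -> E F -> E (residual F p)
}.

Lemma admissibleI E E' : admissible E -> admissible E' -> admissible (E `&` E').
Proof.
move=> [c r] [c' r']; split=> [C C0 CE Ct|F p uF [EF E'F]].
  by split; [apply: c|apply: c'] => // X /CE[].
by split; [exact: r|exact: r'].
Qed.

Lemma admissible_up : admissible up.
Proof.
split=> [C _ Cup _ p q pq [X CX Xp]|F p uF _ q r qr].
  by exists X => //; exact: (Cup X CX p).
by apply: uF; apply: fle_orS => //; exact: fle_refl.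
Qed.

Lemma total_on_finite (C : set (set formula)) (g : nat -> formula) m :
  C !=set0 -> total_on C subset ->
  (forall i, i < m -> (\bigcup_(X in C) X) (g i)) ->
  exists2 X, C X & forall i, i < m -> X (g i).
Proof.
move=> C0 Ct; elim: m => [|m IH] h; first by case: C0 => X CX; exists X.
have [|X CX Xg] := IH; first by move=> i im; apply: h; exact: ltnW.
have [Y CY Yg] := h m (ltnSn m).
have [XY|YX] := Ct _ _ CX CY.
  exists Y => // i; rewrite ltnS leq_eqVlt => /orP[/eqP->//|/Xg]; exact: XY.
by exists X => // i; rewrite ltnS leq_eqVlt => /orP[/eqP->|/Xg//]; exact: YX.
Qed.

(** For residuals, adjunction is applied to the formulas [Or (f j) p]: the given premises lie below
    their partial meets, and [fle_bigAndU] factors [p] out of the conclusion. *)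
Lemma admissible_adj n : 0 < n -> admissible (adj_closed n).
Proof.
move=> n0; split=> [C C0 CE Ct f h|F p uF aF f h].
  have [X CX Xf] := total_on_finite C0 Ct h.
  by exists X => //; exact: (CE X CX).
apply: (uF _ _ (fle_bigAndU _ _ _)) => //; apply: aF => i i_n.
apply: (uF _ _ _ (h i i_n)); apply/fle_bigAnd; first exact: others_neq0.
move=> j jo; apply: fle_orS; last exact: fle_refl.
have := fle_refl (bigAnd [seq f j | j <- others n i]).
by move/(fle_bigAnd _ _ (others_neq0 i n0)); apply.
Qed.

Lemma admissible_lem : admissible lem_closed.
Proof.
split=> [C [X CX] CE _ p|F p uF lF q]; first by exists X => //; exact: CE.
by apply: (uF _ _ _ (lF q)); exact: fle_orl.
Qed.

(** This rule has no side disjunct of its own, so it is applied to [Or q p]; the new conjunct is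
    weakened by [p], and [fle_orI] factors [p] out. *)
Lemma admissible_lem_adj : admissible lem_adj_closed.
Proof.
split=> [C _ CE _ p q [X CX Xp]|F p uF lF q r h].
  by exists X => //; exact: CE.
apply: (uF _ _ _ (lF _ r h)); apply: fle_trans (fle_orI _ _ _).
by apply: fle_andS; [exact: fle_refl|exact: fle_orl].
Qed.

(** The side disjunct of the rule absorbs [p] by associativity. *)
Lemma admissible_efq : admissible efq_closed.
Proof.
split=> [C _ CE _ p q [X CX Xp]|F p uF eF q r h].
  by exists X => //; exact: (CE X CX p).
by apply: (eF q); apply: (uF _ _ _ h); case: (fle_orA (And q (Not q)) r p).
Qed.

Lemma admissible_ko : admissible ko_closed.
Proof.
split=> [C _ CE _ p q r u [X CX Xp]|F p uF kF q r s u h].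
  by exists X => //; exact: (CE X CX p).
apply: (uF _ _ (proj1 (fle_orA _ _ _))); apply: (kF q).
by apply: (uF _ _ (proj2 (fle_orA _ _ _))).
Qed.

Lemma prime_extension E T p : admissible E -> E `<=` up -> E T -> ~ T p ->
  exists F, [/\ T `<=` F, E F, prime F & ~ F p].
Proof.
move=> admE Eup ET nTp.
have [//|C C0 CP Ct|F [TF [EF nFp] Fmax]] :=
    @Zorn_above [set X | E X /\ ~ X p] T.
  split; last by case=> X /CP[].
  by apply: (adm_chain admE) => // X /CP[].
exists F; split=> // q r Fqr; have uF := Eup _ EF.
have sub s : F `<=` residual F s by move=> t; apply: uF; exact: fle_orl.
(* If [residual F s] misses [p], maximality makes it equal to [F]. *)
have max s t : ~ F (Or p s) -> F (Or t s) -> F t.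
  move=> nps Fts; apply: (Fmax _ (sub s)) => //; split=> //.
  exact: (adm_residual admE).
(* Either [residual F r] misses [p] and contains [q], or [residual F p] contains [r]; the latter
   misses [p] because [Or p p] lies below [p]. *)
have [Fpr|nFpr] := pselect (F (Or p r)); last by left; exact: (max r).
right; apply: (max p); last exact: (uF _ _ (fle_orC _ _)).
by move=> /(uF _ _ (fle_or (fle_refl p) (fle_refl p))).
Qed.

(** * Maximal filters inside a prime theory *)

Record max_filter F Q : Prop := MaxFilter {
  maxf_up : up Q;
  maxf_meet : meet_closed Q;
  maxf_sub : Q `<=` F;
  maxf_max : forall X, up X -> meet_closed X -> X `<=` F -> Q `<=` X -> X `<=` Q
}.

Lemma max_filter_above F X : up X -> meet_closed X -> X `<=` F ->
  exists2 Q, X `<=` Q & max_filter F Q.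
Proof.
move=> uX mX XF.
have [//|C C0 CP Ct|Q [XQ [uQ mQ QF] Qmax]] :=
    @Zorn_above [set Y | [/\ up Y, meet_closed Y & Y `<=` F]] X.
  split.
  - by apply: (adm_chain admissible_up) => // Y /CP[].
  - move=> p q [Y CY Yp] [Z CZ Zq].
    have [/(_ p Yp) Zp|/(_ q Zq) Yq] := Ct _ _ CY CZ.
      by exists Z => //; case: (CP Z CZ) => _ mZ _; exact: mZ.
    by exists Y => //; case: (CP Y CY) => _ mY _; exact: mY.
  - by move=> p [Y CY Yp]; case: (CP Y CY) => _ _; apply.
by exists Q => //; split=> // Y uY mY YF QY; exact: Qmax.
Qed.

Lemma max_filter_mem F p : up F -> F p -> exists2 Q, Q p & max_filter F Q.
Proof.
move=> uF Fp; have [|||Q sQ mQ] := @max_filter_above F (fle p).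
- by move=> q r qr pq; exact: fle_trans qr.
- by move=> q r; exact: fle_and.
- by move=> q pq; exact: (uF p).
by exists Q => //; apply: sQ; exact: fle_refl.
Qed.

Section MaxFilter.
Variables (F Q : set formula).
Hypotheses (uF : up F) (mQ : max_filter F Q).

(** Otherwise the filter generated by [Q] and [p] stays inside [F], and maximality puts [p] into
    [Q]. The element [q] witnesses that [Q] is nonempty, so that this filter contains [p]. *)
Lemma max_filter_out p q : Q q -> ~ Q p -> exists2 r, Q r & ~ F (And r p).
Proof.
move=> Qq nQp; apply: contrapT => h; apply: nQp.
pose X : set formula := [set s | exists2 r, Q r & fle (And r p) s].
suff sXQ : X `<=` Q by apply: sXQ; exists q => //; exact: fle_andr.
apply: (maxf_max mQ).
- by move=> s t st [r Qr rs]; exists r => //; exact: fle_trans st.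
- move=> s t [r Qr rs] [r' Qr' rt]; exists (And r r').
    exact: (maxf_meet mQ).
  apply: fle_and; [apply: fle_trans rs|apply: fle_trans rt];
    by apply: fle_andS; [|exact: fle_refl]; do ?[exact: fle_andl|exact: fle_andr].
- move=> s [r Qr rs]; apply: (uF rs); apply: contrapT => nF; apply: h.
  by exists r.
- by move=> s Qs; exists s => //; exact: fle_andl.
Qed.

Lemma max_filter_and p q : Q (And p q) <-> Q p /\ Q q.
Proof.
split; last by case; exact: (maxf_meet mQ).
by move=> h; split; apply: (maxf_up mQ _ h); [exact: fle_andl|exact: fle_andr].
Qed.

(** If [r] and [s] in [Q] exclude [p] and [q], the meet of [r], [s] and [Or p q] is in [F] and
    distributes below [Or (And r p) (And s q)], against primality of [F]. *)
Lemma max_filter_prime : prime F -> prime Q.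
Proof.
move=> pF p q Qpq; apply: contrapT => /not_orP[nQp nQq].
have [r Qr nr] := max_filter_out Qpq nQp.
have [s Qs ns] := max_filter_out Qpq nQq.
have : F (Or (And r p) (And s q)) by
  apply: (uF _ (maxf_sub mQ (maxf_meet mQ (maxf_meet mQ Qr Qs) Qpq)));
  apply: (fle_trans (fle_distr _ _ _)); apply: fle_orS;
  apply: fle_andS; do ?[exact: fle_refl|exact: fle_andl|exact: fle_andr].
by case/pF.
Qed.

End MaxFilter.

Lemma max_filter_incompatible F Q Q' : up F -> max_filter F Q ->
  max_filter F Q' -> Q <> Q' -> exists p q, [/\ Q p, Q' q & ~ F (And p q)].
Proof.
move=> uF mQ mQ' neq.
have [q Q'q nQq] : exists2 q, Q' q & ~ Q q.
  apply: contrapT => h; apply: neq.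
  have sQ'Q : Q' `<=` Q.
    by move=> q Q'q; apply: contrapT => nQq; apply: h; exists q.
  apply/seteqP; split=> //.
  exact: (maxf_max mQ' (maxf_up mQ) (maxf_meet mQ) (maxf_sub mQ)).
(* [max_filter_out] asks for an element of [Q]. An empty [Q] is contained in [Q'], and its
   maximality would put [q] into it. *)
have [[p Qp]|Q0] := pselect (exists p, Q p).
  by have [r Qr nr] := max_filter_out uF mQ Qp nQq; exists r, q.
case: nQq; apply: (maxf_max mQ (maxf_up mQ') (maxf_meet mQ') (maxf_sub mQ')) => //.
by move=> p Qp; case: Q0; exists p.
Qed.

(* For [r i] in the [i]-th filter with pairwise meets outside [F], the joins of
   all [r j] but one are [n+1] elements whose [n]-fold meets lie above some
   [r i], so [n]-adjunction puts their full meet [\/_{i<j} r i /\ r j] in [F]. *)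
Lemma max_filter_bound n F (Q : nat -> set formula) : 0 < n ->
  up F -> prime F -> adj_closed n F -> (forall i, max_filter F (Q i)) ->
  ~ (forall i j, i < n.+1 -> j < n.+1 -> i != j -> Q i <> Q j).
Proof.
move=> n0 uF pF aF mQ dQ.
have /choice[c cP] : forall ij : nat * nat, exists pq : formula * formula,
    ij.1 < n.+1 -> ij.2 < n.+1 -> ij.1 != ij.2 ->
    [/\ Q ij.1 pq.1, Q ij.2 pq.2 & ~ F (And pq.1 pq.2)].
  case=> i j /=.
  have [[[i_n j_n] ij]|h] := pselect ((i < n.+1 /\ j < n.+1) /\ i != j).
    have [p [q H]] := max_filter_incompatible uF (mQ i) (mQ j)
      (dQ i j i_n j_n ij).
    by exists (p, q).
  by exists (Var 0, Var 0) => i_n j_n ij; case: h.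
(* The choice [c] depends on the order of the indices, so [d i j] collects the entries in [Q i] of
   both [c (i, j)] and [c (j, i)]. Hence [And (r i) (r j)] lies below the meet of the pair
   [c (i, j)]. *)
pose d i j := And (c (i, j)).1 (c (j, i)).2.
pose r i := bigAnd [seq d i j | j <- others n i].
have Qr i : i < n.+1 -> Q i (r i).
  move=> i_n; apply/bigAnd_mem; [exact: (max_filter_and (mQ i))|exact: others_neq0|].
  move=> j; rewrite mem_others eq_sym => /andP[ij j_n].
  apply: (maxf_meet (mQ i)); first by case: (cP (i, j) i_n j_n ij).
  by rewrite eq_sym in ij; case: (cP (j, i) j_n i_n ij).
have rd i j : i < n.+1 -> j < n.+1 -> i != j -> fle (r i) (d i j).
  move=> i_n j_n ij; have := fle_refl (r i).
  move/(fle_bigAnd _ _ (others_neq0 i n0)); apply.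
  by rewrite mem_others eq_sym ij.
have nFr i j : i < n.+1 -> j < n.+1 -> i != j -> ~ F (And (r i) (r j)).
  move=> i_n j_n ij Frr; case: (cP (i, j) i_n j_n ij) => _ _; apply.
  apply: (uF _ _ _ Frr); apply: fle_andS.
    by apply: (fle_trans (rd i j i_n j_n ij)); exact: fle_andl.
  rewrite eq_sym in ij.
  by apply: (fle_trans (rd j i j_n i_n ij)); exact: fle_andr.
pose s i := bigOr [seq r j | j <- others n i].
have : F (bigAnd [seq s j | j <- iota 0 n.+1]).
  apply: aF => i i_n; apply: (uF (r i)); last exact: (maxf_sub (mQ i)) (Qr i i_n).
  apply/fle_bigAnd; first exact: others_neq0.
  move=> j; rewrite mem_others => /andP[ji j_n]; apply: fle_bigOr.
  by rewrite mem_others eq_sym ji.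
(* A prime filter [P] through the full meet contains some [r i] because of [s 0], then some [r j]
   with [j != i] because of [s i]; their meet would be in [F]. *)
case/(max_filter_mem uF) => P Ps mP.
have pP := max_filter_prime uF mP pF.
have {}Ps j : j < n.+1 -> P (s j).
  move=> j_n; move/bigAnd_mem: Ps; apply=> //; first exact: (max_filter_and mP).
  by rewrite mem_iota.
have [i] := prime_bigOr pP (others_neq0 0 n0) (Ps 0 isT).
rewrite mem_others => /andP[_ i_n] Pi.
have [j] := prime_bigOr pP (others_neq0 i n0) (Ps i i_n).
rewrite mem_others => /andP[ji j_n] Pj.
exact: (nFr j i j_n i_n ji) (maxf_sub mP (maxf_meet mP Pj Pi)).
Qed.

(** Greedy choice: as long as at most [n] filters leave a formula of [F] uncovered, a maximal filter
    through it is new; [n.+1] distinct ones contradict [max_filter_bound]. Repetitions in [Q] are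
    allowed. *)
Lemma max_filter_cover n F : 0 < n -> up F -> prime F -> adj_closed n F ->
  exists Q : nat -> set formula, (forall i, max_filter F (Q i)) /\
    (forall p, F p -> exists2 i, i < n & Q i p).
Proof.
move=> n0 uF pF aF; apply: contrapT => nc.
suff H k : k <= n.+1 -> exists Q : nat -> set formula,
    (forall i, max_filter F (Q i)) /\
    (forall i j, i < k -> j < k -> i != j -> Q i <> Q j).
  by have [Q [mQ dQ]] := H _ (leqnn _); exact: (max_filter_bound n0 uF pF aF mQ dQ).
elim: k => [_|k IH k_n].
  by have [|||Q _ mQ] := @max_filter_above F set0 => //; exists (fun=> Q).
have [Q [mQ dQ]] := IH (ltnW k_n).
have [p Fp np] : exists2 p, F p & forall i, i < k -> ~ Q i p.
  apply: contrapT => h; apply: nc; exists Q; split=> // p Fp.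
  apply: contrapT => h'; apply: h; exists p => // i ik Qip.
  by apply: h'; exists i => //; exact: leq_trans ik _.
have [P Pp mP] := max_filter_mem uF Fp.
exists (fun i => if i == k then P else Q i); split=> [i|i j].
  by case: ifP.
have neP h : h < k -> Q h <> P by move=> /np + e; rewrite e.
rewrite !ltnS (leq_eqVlt i) (leq_eqVlt j).
case: (eqVneq i k) => [->|_] /=; case: (eqVneq j k) => [->|_] //=.
- by move=> _ jk _ /esym; exact: neP.
- by move=> ik _ _; exact: neP.
- exact: dQ.
Qed.

(** * Valuations as sets of formulas *)

(** Membership of [q] and of [Not q] are the two coordinates of a four-valued valuation; the clauses
    express that it is a homomorphism. *)
Record bd_set Q : Prop := BdSet {
  bd_and : forall p q, Q (And p q) <-> Q p /\ Q q;
  bd_or : forall p q, Q (Or p q) <-> Q p \/ Q q;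
  bd_notnot : forall p, Q (Not (Not p)) <-> Q p;
  bd_notand : forall p q, Q (Not (And p q)) <-> Q (Not p) \/ Q (Not q);
  bd_notor : forall p q, Q (Not (Or p q)) <-> Q (Not p) /\ Q (Not q)
}.

Lemma max_filter_bd F Q : up F -> prime F -> max_filter F Q -> bd_set Q.
Proof.
move=> uF pF mQ; have uQ := maxf_up mQ; have QI := max_filter_and mQ.
have QU p q : Q (Or p q) <-> Q p \/ Q q.
  split; first exact: (max_filter_prime uF mQ pF).
  by case; apply: uQ; [exact: fle_orl|exact: fle_orr].
have Qeq p q : fle p q /\ fle q p -> Q p <-> Q q.
  by case=> pq qp; split; exact: uQ.
split=> // [p|p q|p q]; first exact: Qeq (fle_notnot p).
- by rewrite -QU; exact: Qeq (fle_notand p q).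
- by rewrite -QI; exact: Qeq (fle_notor p q).
Qed.

(** [a] records whether a formula is designated and [b] whether its negation is. *)
Definition four_of (a b : bool) : four :=
  if a then if b then vb else vt else if b then vf else vn.

Definition val4 Q q : DM1 := four_of `[< Q q >] `[< Q (Not q) >].

Definition is_des (x : four) : bool :=
  match x with vt | vb => true | _ => false end.

Lemma is_desP (x : DM1) : designated DM1 x <-> is_des x.
Proof. by case: x; split=> //; [case|case|right|left]. Qed.

Lemma val4_des Q q : designated DM1 (val4 Q q) <-> Q q.
Proof.
rewrite is_desP /val4; split; first by case: asboolP => // _; case: asboolP.
by move/asboolP => ->; case: asboolP.
Qed.

Lemma val4_hom Q : bd_set Q -> is_hom (A := formula_algebra) (val4 Q).
Proof.
move=> [QI QU QNN QNI QNU].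
have andE a b : `[< a /\ b >] = `[< a >] && `[< b >] by exact: asbool_and.
have orE a b : `[< a \/ b >] = `[< a >] || `[< b >] by exact: asbool_or.
split=> [p q|p q|p]; rewrite /val4 /=.
- rewrite (propext (QI p q)) (propext (QNI p q)) andE orE.
  by do 4 case: `[< _ >].
- rewrite (propext (QU p q)) (propext (QNU p q)) andE orE.
  by do 4 case: `[< _ >].
- by rewrite (propext (QNN p)); do 2 case: `[< _ >].
Qed.

Lemma des_bd (v : formula -> DM1) : is_hom (A := formula_algebra) v ->
  bd_set [set q | designated DM1 (v q)].
Proof.
move=> h; set Q := (X in bd_set X).
have QE q : Q q <-> is_des (v q) by exact: is_desP.
split=> [p q|p q|p|p q|p q]; rewrite !QE !(formula_homE h)
    ?(rwP andP) ?(rwP orP);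
  by case: (v p); try case: (v q); split.
Qed.

(** An element of [DM1] is determined by whether it and its negation are designated. *)
Lemma val4_desE (v : formula -> DM1) q : is_hom (A := formula_algebra) v ->
  val4 [set q | designated DM1 (v q)] q = v q.
Proof.
move=> h; rewrite /val4 /mkset (formula_homE h) !(propext (is_desP _)) !asboolb.
by case: (v q).
Qed.

(* Valuations into [M], up to which formulas they designate, are exactly the
   members of [X]. *)
Definition represents (M : structure) (X : set (set formula)) : Prop :=
  (forall v : formula -> M, is_hom (A := formula_algebra) v ->
     X [set q | designated M (v q)]) /\
  (forall Q, X Q -> exists v : formula -> M,
     is_hom (A := formula_algebra) v /\ forall q, designated M (v q) <-> Q q).

Lemma represents_DM1 : represents DM1 bd_set.
Proof.
split=> [v|Q bQ]; first exact: des_bd.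
by exists (val4 Q); split; [exact: val4_hom|exact: val4_des].
Qed.

Lemma represents_sub (S : DM1 -> bool) SI SU SN :
  represents (@substructure DM1 S SI SU SN)
    [set Q | bd_set Q /\ forall q, S (val4 Q q)].
Proof.
split=> [v h|Q [bQ SQ]].
  have h' : is_hom (A := formula_algebra) (B := DM1) (fun q => sval (v q)).
    by split=> [p q|p q|p]; rewrite (formula_homE h).
  split; first exact: (des_bd h').
  by move=> q; rewrite (val4_desE q h'); exact: (svalP (v q)).
exists (fun q => exist (fun w => S w) (val4 Q q) (SQ q)); split; last first.
  exact: val4_des.
by split=> [p q|p q|p]; apply: val_inj; rewrite /= (formula_homE (val4_hom bQ)).
Qed.

(** Totality excludes the value [vn]; consistency, in [k_set], excludes [vb]. *)
Definition lp_set : set (set formula) :=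
  [set Q | bd_set Q /\ forall q, Q q \/ Q (Not q)].
Definition k_set : set (set formula) :=
  [set Q | bd_set Q /\ forall q, ~ (Q q /\ Q (Not q))].
Definition cl_set : set (set formula) := lp_set `&` k_set.

Lemma in_P_val4 Q q : in_P (val4 Q q) <-> Q q \/ Q (Not q).
Proof. by rewrite /val4; do 2 case: asboolP => ?; split=> //=; tauto. Qed.

Lemma in_K_val4 Q q : in_K (val4 Q q) <-> ~ (Q q /\ Q (Not q)).
Proof. by rewrite /val4; do 2 case: asboolP => ?; split=> //=; tauto. Qed.

Lemma represents_P1 : represents P1 lp_set.
Proof.
rewrite (_ : lp_set = [set Q | bd_set Q /\ forall q, in_P (val4 Q q)]).
  exact: represents_sub.
by apply/seteqP; split=> Q [bQ h]; split=> // q; apply/in_P_val4.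
Qed.

Lemma represents_K1 : represents K1 k_set.
Proof.
rewrite (_ : k_set = [set Q | bd_set Q /\ forall q, in_K (val4 Q q)]).
  exact: represents_sub.
by apply/seteqP; split=> Q [bQ h]; split=> // q; apply/in_K_val4.
Qed.

Lemma represents_B1 : represents B1 cl_set.
Proof.
rewrite (_ : cl_set = [set Q | bd_set Q /\ forall q, in_B (val4 Q q)]).
  exact: represents_sub.
apply/seteqP; split=> Q /=.
  move=> [[bQ h] [_ h']]; split=> // q.
  by apply/andP; split; [apply/in_P_val4|apply/in_K_val4].
move=> [bQ h]; split; split=> // q; case/andP: (h q).
  by move/in_P_val4.
by move=> _ /in_K_val4.
Qed.

(** Consequence in a dual product: a valuation amounts to a family [Q] of coordinate valuations, and
    a formula is designated when some coordinate designates it. *)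
Definition sem (I : Type) (X : I -> set (set formula)) : conseq := fun G p =>
  forall Q : I -> set formula, (forall k, X k (Q k)) ->
    (forall q, G q -> exists k, Q k q) -> exists k, Q k p.

Lemma valid_dual_product (I : Type) (M : I -> structure)
    (X : I -> set (set formula)) (G : set formula) p :
  (forall k, represents (M k) (X k)) -> valid (dual_product M) G p <-> sem X G p.
Proof.
move=> rM; split.
  move=> val Q XQ GQ.
  have [v vP] : exists v : forall k, formula -> M k, forall k,
      is_hom (A := formula_algebra) (v k) /\
      forall q, designated (M k) (v k q) <-> Q k q.
    have w k := cid ((rM k).2 _ (XQ k)).
    by exists (fun k => sval (w k)) => k; exact: (svalP (w k)).
  have [||k _] := val (fun q k => v k q).
  - by split=> [q r|q r|q]; apply: functional_extensionality_dep => k /=;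
      rewrite (formula_homE (vP k).1).
  - by move=> _ [q /GQ[k Qkq] <-]; exists k => //; apply/(vP k).2.
  - by move/(vP k).2; exists k.
move=> s v h GD.
have [k||k] := s (fun k => [set q | designated (M k) (v q k)]).
- apply: (rM k).1 (fun q => v q k) _.
  by split=> [q r|q r|q]; rewrite (formula_homE h).
- by move=> q Gq; have [|k _ ?] := GD (v q); [exists q|exists k].
- by exists k.
Qed.

(** * Soundness *)

Lemma valid_logic (M : structure) : is_logic (valid M).
Proof.
split=> [G p Gp v h|G D p GD val v h DM|G D p cut val v h GM|s G p hs val v h GM].
- by apply; exists p.
- by apply: val => // _ [q Gq <-]; apply: DM; exists q => //; exact: GD.
- apply: val => // _ [q [Gq|Dq] <-]; first by apply: GM; exists q.
  exact: cut.
- apply: (val (v \o s)).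
    by split=> [q r|q r|q] /=; rewrite (formula_homE hs) (formula_homE h).
  by move=> _ [q Gq <-]; apply: GM; exists (s q) => //; exists q.
Qed.

Lemma de_morgan_DM1 : de_morgan_lattice DM1.
Proof. by split; do ?case. Qed.

(** Enlarging each [X k] to [bd_set] reduces this to a dual power of [DM1], which is a De Morgan
    lattice with an upset of designated elements. *)
Lemma BD_infty_sem (I : Type) (X : I -> set (set formula)) G p :
  (forall k, X k `<=` bd_set) -> BD_infty G p -> sem X G p.
Proof.
move=> Xbd BDp Q XQ; move: {XQ}(fun k => Xbd k _ (XQ k)).
move: Q; change (sem (fun _ : I => bd_set) G p).
apply/(valid_dual_product (M := fun=> DM1)); first
  by move=> _; exact: represents_DM1.
apply: BDp; have dm := de_morgan_DM1; split.
  split; intros; apply: functional_extensionality_dep => k /=;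
  by [apply: dml_meetA dm _ _ _|apply: dml_joinA dm _ _ _
     |apply: dml_meetC dm _ _|apply: dml_joinC dm _ _
     |apply: dml_meetK dm _ _|apply: dml_joinK dm _ _
     |apply: dml_meet_joinr dm _ _ _|apply: dml_negK dm _
     |apply: dml_neg_meet dm _ _|apply: dml_neg_join dm _ _].
move=> x y [k _ /is_desP xk] xy; exists k => //; apply/is_desP.
have {xy} : meet4 (x k) (y k) = x k by exact: (congr1 (fun a => a k) xy).
by move: xk; case: (x k); case: (y k).
Qed.

Lemma sem_adj (I : finType) (X : I -> set (set formula)) n : 0 < n -> #|I| <= n ->
  (forall k, X k `<=` bd_set) -> sem X (adj_rule n).1 (adj_rule n).2.
Proof.
move=> n0 In Xbd Q XQ GQ.
have QI k p q : Q k (And p q) <-> Q k p /\ Q k q.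
  by apply: bd_and; exact: (Xbd k).
have /choice[c cP] : forall i : 'I_n.+1, exists k,
    forall j, j < n.+1 -> j != i -> Q k (Var j).
  move=> i; have [|k Qk] := GQ (bigAnd [seq Var j | j <- others n i]).
    by exists (i : nat) => //=.
  exists k => j j_n ji; move/(bigAnd_mem _ (QI k) (others_neq0 i n0)): Qk.
  by apply; rewrite mem_others ji.
(* Two of the [n.+1] premises hold in the same factor. It satisfies every variable except perhaps
   [Var i], by one, and every variable except perhaps [Var i'], by the other. *)
have /injectivePn[i [i' ii' ci]] : ~~ injectiveb c.
  apply/negP => /injectiveP /leq_card; rewrite card_ord => h.
  by have := leq_trans h In; rewrite ltnn.
exists (c i); apply/bigAnd_mem => // j; rewrite mem_iota => /andP[_ j_n].
have [ji|ji] := eqVneq j (i : nat); last exact: cP.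
rewrite ci; apply: cP => //; apply: contra ii' => /eqP ji'.
by apply/eqP/val_inj; rewrite /= -ji -ji'.
Qed.

(** With no premise to point to a factor, [k0] supplies one. *)
Lemma sem_lem (I : Type) (X : I -> set (set formula)) (k0 : I) :
  (forall k, X k `<=` lp_set) -> sem X lem_rule.1 lem_rule.2.
Proof.
move=> Xlp Q XQ _; have [bQ h] := Xlp k0 _ (XQ k0).
by exists k0; apply/(bd_or bQ).
Qed.

Lemma sem_lem_adj (I : Type) (X : I -> set (set formula)) :
  (forall k, X k `<=` lp_set) -> sem X lem_adj_rule.1 lem_adj_rule.2.
Proof.
move=> Xlp Q XQ /(_ _ erefl)[k Qk]; have [bQ h] := Xlp k _ (XQ k).
by exists k; apply/(bd_and bQ); split=> //; apply/(bd_or bQ).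
Qed.

Lemma sem_efq (I : Type) (X : I -> set (set formula)) :
  (forall k, X k `<=` k_set) -> sem X efq_rule.1 efq_rule.2.
Proof.
move=> Xk Q XQ /(_ _ erefl)[k Qk]; have [bQ h] := Xk k _ (XQ k).
by exists k; move/(bd_or bQ): Qk => [/(bd_and bQ)/h|].
Qed.

(** In each factor, either excluded middle always holds or a contradiction never does. *)
Lemma sem_ko (I : Type) (X : I -> set (set formula)) :
  (forall k, X k `<=` lp_set `|` k_set) -> sem X ko_rule.1 ko_rule.2.
Proof.
move=> Xk Q XQ /(_ _ erefl)[k Qk]; exists k.
have [[bQ h]|[bQ h]] := Xk k _ (XQ k); move/(bd_or bQ): Qk;
  case=> [/(bd_and bQ)[xx z]|u]; apply/(bd_or bQ); do ?by right.
- by left; apply/(bd_and bQ); split=> //; apply/(bd_or bQ).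
- by case/(bd_and bQ)/h: xx.
Qed.

(** * Completeness *)

Lemma extension_logic (L : conseq) R : is_logic (extension L R).
Proof.
split=> [G p Gp|G D p GD h|G D p cut h|s G p hs h] L' L'l LL' RL'.
- exact: logic_refl.
- by apply: (logic_mono L'l GD); exact: h.
- by apply: (logic_cut L'l (D := D)); [move=> q Dq; exact: cut|exact: h].
- by apply: (logic_subst L'l hs); exact: h.
Qed.

Lemma extension_sub (L : conseq) R G p : L G p -> extension L R G p.
Proof. by move=> Lp L' _ LL' _; exact: LL'. Qed.

Lemma extension_rule (L : conseq) R (r : rule) : R r -> extension L R r.1 r.2.
Proof. by move=> Rr L' _ _; apply. Qed.

(** * Closure of the theories of a logic under instances of its rules *)

Fixpoint subst (f : nat -> formula) (p : formula) : formula :=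
  match p with
  | Var i => f i
  | And q r => And (subst f q) (subst f r)
  | Or q r => Or (subst f q) (subst f r)
  | Not q => Not (subst f q)
  end.

Lemma subst_bigAnd f l : l != [::] ->
  subst f (bigAnd [seq Var j | j <- l]) = bigAnd [seq f j | j <- l].
Proof.
case: l => //= a l _; rewrite -[f a]/(subst f (Var a)); move: (Var a).
by elim: l => //= b l IH p; rewrite IH.
Qed.

Section LogicTheory.
Variable L : conseq.
Hypothesis Ll : is_logic L.
Hypothesis BDL : forall G p, BD_infty G p -> L G p.

Lemma logic_rule (r : rule) f G : L r.1 r.2 ->
  (forall q, r.1 q -> L G (subst f q)) -> L G (subst f r.2).
Proof.
move=> Lr h; apply: (logic_cut Ll (D := subst f @` r.1)).
  by move=> _ [q rq <-]; exact: h.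
apply: (logic_mono Ll (G := subst f @` r.1)); first by move=> q; right.
exact: (logic_subst Ll).
Qed.

Lemma logic_up G : up (L G).
Proof.
move=> p q pq Lp; apply: (logic_cut Ll (D := [set p])); first by move=> _ ->.
apply: (logic_mono Ll (G := [set p])); first by move=> r; right.
apply: BDL => M [dm uM] v h /(_ (v p)) Mp.
by apply: (uM (v p)); [apply: Mp; exists p|exact: pq].
Qed.

Lemma logic_adj n G : 0 < n -> L (adj_rule n).1 (adj_rule n).2 ->
  adj_closed n (L G).
Proof.
move=> n0 La f h; rewrite -subst_bigAnd //; apply: (logic_rule La).
by move=> _ [i i_n <-]; rewrite (subst_bigAnd f (others_neq0 i n0)); exact: h.
Qed.

Lemma logic_lem G : L lem_rule.1 lem_rule.2 -> lem_closed (L G).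
Proof. by move=> Lr p; apply: (logic_rule (f := fun=> p) Lr). Qed.

Lemma logic_lem_adj G : L lem_adj_rule.1 lem_adj_rule.2 ->
  lem_adj_closed (L G).
Proof.
(* The substitution sends [Var 0] to [p], [Var 1] to [q] and all other variables to the default
   [p]. *)
by move=> Lr p q Lp; apply: (logic_rule (f := nth p [:: p; q]) Lr) => _ ->.
Qed.

Lemma logic_efq G : L efq_rule.1 efq_rule.2 -> efq_closed (L G).
Proof.
by move=> Lr p q Lp; apply: (logic_rule (f := nth p [:: p; q]) Lr) => _ ->.
Qed.

Lemma logic_ko G : L ko_rule.1 ko_rule.2 -> ko_closed (L G).
Proof.
move=> Lr p q r u Lp.
by apply: (logic_rule (f := nth p [:: p; q; r; u]) Lr) => _ ->.
Qed.

(** The part common to all five completeness proofs; [E] carries the rules other than adjunction. *)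
Lemma logic_cover n E G p : 0 < n -> L (adj_rule n).1 (adj_rule n).2 ->
  admissible E -> E (L G) -> ~ L G p ->
  exists F (Q : 'I_n -> set formula),
    [/\ up F, prime F, E F, ~ F p & forall k, max_filter F (Q k)] /\
    (forall q, G q -> exists k, Q k q).
Proof.
move=> n0 La admE EL nLp.
have [||||F [LF [[uF aF] EF] pF nFp]] :=
    @prime_extension ((up `&` adj_closed n) `&` E) (L G) p.
- do 2 apply: admissibleI => //; [exact: admissible_up|exact: admissible_adj].
- by move=> F [[]].
- by split=> //; split; [exact: logic_up|exact: logic_adj].
- by [].
have [Q [mQ FQ]] := max_filter_cover n0 uF pF aF.
exists F, (fun k => Q k); split=> // q Gq.
have [i i_n Qiq] := FQ q (LF q (logic_refl Ll Gq)).
by exists (Ordinal i_n).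
Qed.

Lemma logic_complete n E (X : set (set formula)) G p : 0 < n ->
  L (adj_rule n).1 (adj_rule n).2 -> admissible E -> E (L G) ->
  (forall F Q, up F -> prime F -> E F -> ~ F p -> max_filter F Q -> X Q) ->
  sem (fun _ : 'I_n => X) G p -> L G p.
Proof.
move=> n0 La admE EL EX semp; apply: contrapT => nLp.
have [F [Q [[uF pF EF nFp mQ] GQ]]] := logic_cover n0 La admE EL nLp.
have [k|k Qkp] := semp Q _ GQ; first exact: (EX F).
exact: nFp (maxf_sub (mQ k) Qkp).
Qed.

End LogicTheory.

(** * Effect of the additional rules on maximal filters *)

(** For nonempty [Q], [lem_adj_closed] keeps every meet with [Or q (Not q)] inside [F]. For empty
    [Q], [lem_closed] places the principal filter of [Or q (Not q)] inside [F], against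
    maximality. *)
Lemma max_filter_lp F Q : up F -> prime F -> lem_closed F -> lem_adj_closed F ->
  max_filter F Q -> lp_set Q.
Proof.
move=> uF pF lF laF mQ; have bQ := max_filter_bd uF pF mQ; split=> // q.
apply/(bd_or bQ); have [[p Qp]|Q0] := pselect (exists p, Q p).
  apply: contrapT => /(max_filter_out uF mQ Qp)[r Qr]; apply.
  by apply: laF; exact: (maxf_sub mQ).
apply: (maxf_max mQ (X := fle (Or q (Not q)))).
- by move=> r s rs qr; exact: fle_trans rs.
- by move=> r s; exact: fle_and.
- by move=> r qr; exact: uF qr (lF q).
- by move=> r Qr; case: Q0; exists r.
- exact: fle_refl.
Qed.

(** A contradiction in [Q], weakened by the disjunct [p], would put [p] into [F]. *)
Lemma max_filter_k F Q p : up F -> prime F -> efq_closed F -> ~ F p ->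
  max_filter F Q -> k_set Q.
Proof.
move=> uF pF eF nFp mQ; have bQ := max_filter_bd uF pF mQ; split=> // q Qqq.
apply: nFp; apply: (eF q); apply: (uF _ _ (fle_orl _ _)); apply: (maxf_sub mQ).
exact/(bd_and bQ).
Qed.

(** If [Q] lacks [q] and [Not q], some [s] in [Q] has its meet with [Or q (Not q)] outside [F]. A
    contradiction in [Q], met with [s] and joined with [p], would yield that meet or [p] in [F]. *)
Lemma max_filter_ko F Q p : up F -> prime F -> ko_closed F -> ~ F p ->
  max_filter F Q -> lp_set Q \/ k_set Q.
Proof.
move=> uF pF kF nFp mQ; have bQ := max_filter_bd uF pF mQ.
have [h|] := pselect (forall q, Q q \/ Q (Not q)); first by left.
move/existsNP => [q nQq]; right; split=> // r /(bd_and bQ) Qrr.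
have [|s Qs] := max_filter_out uF mQ (p := Or q (Not q)) Qrr.
  by move/(bd_or bQ).
apply; apply: (uF _ _ (fle_andC _ _)).
have : F (Or (And (And r (Not r)) s) p).
  by apply: (uF _ _ (fle_orl _ _)); apply: (maxf_sub mQ); exact: (maxf_meet mQ).
by move/(kF r q) => /pF[].
Qed.

(** The total sets go to [P1] factors and the remaining ones to [K1] factors; [e] enumerates the two
    classes, whose sizes add up to [n]. *)
Lemma sem_PK_complete n (Q : 'I_n -> set formula) G p :
  (forall k, lp_set (Q k) \/ k_set (Q k)) ->
  (forall q, G q -> exists k, Q k q) ->
  (forall i j, i + j = n -> valid (PK i j) G p) -> exists k, Q k p.
Proof.
move=> Qlk GQ val; pose B := [pred k | `[< lp_set (Q k) >]].
have BP k : reflect (lp_set (Q k)) (k \in B) by exact: asboolP.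
have cardB : #|B| + #|[predC B]| = n by rewrite cardC card_ord.
pose e (k : 'I_#|B| + 'I_#|[predC B]|) : 'I_n :=
  match k with inl a => enum_val a | inr a => enum_val a end.
have {val} := val _ _ cardB.
rewrite (valid_dual_product _ _
    (X := fun k => if k is inl _ then lp_set else k_set)).
  move=> /(_ (Q \o e))[[a|a]||k Qkp].
  - exact/BP/(enum_valP a).
  - by have /BP := enum_valP a; case: (Qlk (enum_val a)).
  - move=> q /GQ[k Qkq]; have [Bk|Bk] := boolP (k \in B).
      by exists (inl (enum_rank_in Bk k)); rewrite /= enum_rankK_in.
    have Bk' : k \in [predC B] by [].
    by exists (inr (enum_rank_in Bk' k)); rewrite /= enum_rankK_in.
  - by exists (e k).
by case=> a; [exact: represents_P1|exact: represents_K1].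
Qed.

Theorem mainTheorem8 (n : nat) (hn : (1 <= n)%N) :
  (forall (G : set formula) (p : formula), BD n G p <-> valid (DMn n) G p) /\
  (forall (G : set formula) (p : formula), LP n G p <-> valid (Pn n) G p) /\
  (forall (G : set formula) (p : formula), K n G p <-> valid (Kn n) G p) /\
  (forall (G : set formula) (p : formula), CL n G p <-> valid (Bn n) G p) /\
  (forall (G : set formula) (p : formula),
     KO n G p <-> (forall i j : nat, (i + j)%N = n -> valid (PK i j) G p)).
Proof.
have k0 : 'I_n by exact: Ordinal hn.
have cardn : #|'I_n| <= n by rewrite card_ord.
have extR L R R' (r : rule) : R r -> extension (extension L R) R' r.1 r.2.
  by move=> Rr; apply: extension_sub; exact: extension_rule.
have extBD R R' G p : BD_infty G p -> extension (extension BD_infty R) R' G p.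
  by move=> h; do 2 apply: extension_sub.
have extA L : extension L [set adj_rule n] (adj_rule n).1 (adj_rule n).2.
  exact: extension_rule.
have subXX (X : set (set formula)) : X `<=` X by exact: subset_refl.
have lpbd : lp_set `<=` bd_set by move=> Q [].
have kbd : k_set `<=` bd_set by move=> Q [].
have clbd : cl_set `<=` bd_set by move=> Q [[]].
have vDM G p : valid (DMn n) G p <-> sem (fun _ : 'I_n => bd_set) G p.
  by apply: valid_dual_product => _; exact: represents_DM1.
have vP G p : valid (Pn n) G p <-> sem (fun _ : 'I_n => lp_set) G p.
  by apply: valid_dual_product => _; exact: represents_P1.
have vK G p : valid (Kn n) G p <-> sem (fun _ : 'I_n => k_set) G p.
  by apply: valid_dual_product => _; exact: represents_K1.
have vB G p : valid (Bn n) G p <-> sem (fun _ : 'I_n => cl_set) G p.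
  by apply: valid_dual_product => _; exact: represents_B1.
split; [|split; [|split; [|split]]]; move=> G p.
- split.
    (* An extension lies below every logic with its rules, in particular below validity in the
       structure. *)
    apply; first exact: valid_logic.
      by move=> D q h; apply/vDM; exact: BD_infty_sem h.
    by move=> _ ->; apply/vDM; exact: sem_adj.
  move/vDM; apply: (logic_complete _ _ (E := setT)) => //.
  + exact: extension_logic.
  + by move=> D q; exact: extension_sub.
  + exact: extA.
  + by move=> F Q uF pF _ _; exact: max_filter_bd.
- split.
    apply; first exact: valid_logic; last first.
      by move=> _ ->; apply/vP; exact: sem_adj.
    move=> D q; apply; first exact: valid_logic.
      by move=> D' q' h; apply/vP; exact: BD_infty_sem h.
    by move=> _ [->|->]; apply/vP; [exact: sem_lem|exact: sem_lem_adj].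
  move/vP; apply: (logic_complete _ _ (E := lem_closed `&` lem_adj_closed)) => //.
  + exact: extension_logic.
  + exact: extBD.
  + exact: extA.
  + by apply: admissibleI; [exact: admissible_lem|exact: admissible_lem_adj].
  + split; [apply: logic_lem|apply: logic_lem_adj]; try exact: extension_logic.
      by apply: extR; left.
    by apply: extR; right.
  + by move=> F Q uF pF [lF laF] _; exact: max_filter_lp.
- split.
    apply; first exact: valid_logic; last first.
      by move=> _ ->; apply/vK; exact: sem_adj.
    move=> D q; apply; first exact: valid_logic.
      by move=> D' q' h; apply/vK; exact: BD_infty_sem h.
    by move=> _ ->; apply/vK; exact: sem_efq.
  move/vK; apply: (logic_complete _ _ (E := efq_closed)) => //.
  + exact: extension_logic.
  + exact: extBD.
  + exact: extA.
  + exact: admissible_efq.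
  + by apply: logic_efq; [exact: extension_logic|exact: extR].
  + by move=> F Q uF pF eF nFp; exact: (max_filter_k (p := p)).
- split.
    apply; first exact: valid_logic; last first.
      by move=> _ ->; apply/vB; exact: sem_adj.
    move=> D q; apply; first exact: valid_logic.
      by move=> D' q' h; apply/vB; exact: BD_infty_sem h.
    move=> _ [[->|->]|->]; apply/vB.
    * by apply: sem_lem => // k Q [].
    * by apply: sem_lem_adj => // k Q [].
    * by apply: sem_efq => k Q [].
  move/vB; apply: (logic_complete _ _
    (E := (lem_closed `&` lem_adj_closed) `&` efq_closed)) => //.
  + exact: extension_logic.
  + exact: extBD.
  + exact: extA.
  + by apply: admissibleI; [apply: admissibleI|];
      [exact: admissible_lem|exact: admissible_lem_adj|exact: admissible_efq].
  + split; [split|]; [apply: logic_lem|apply: logic_lem_adj|apply: logic_efq];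
      try exact: extension_logic.
    * by apply: extR; left; left.
    * by apply: extR; left; right.
    * by apply: extR; right.
  + move=> F Q uF pF [[lF laF] eF] nFp mQ; split; first exact: (max_filter_lp uF).
    exact: (max_filter_k uF pF eF nFp).
split.
  move=> KOp i j ijn.
  pose X (k : 'I_i + 'I_j) := if k is inl _ then lp_set else k_set.
  have vPK D q : valid (PK i j) D q <-> sem X D q.
    by apply: valid_dual_product => -[a|a];
      [exact: represents_P1|exact: represents_K1].
  have Xbd k : X k `<=` bd_set by case: k.
  apply: KOp; first exact: valid_logic; last first.
    move=> _ ->; apply/vPK; apply: sem_adj => //.
    by rewrite card_sum !card_ord ijn.
  move=> D q; apply; first exact: valid_logic.
    by move=> D' q' h; apply/vPK; exact: BD_infty_sem h.
  move=> _ ->; apply/vPK; apply: sem_ko.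
  by move=> [a|a] Q; [left|right].
move=> val; apply: contrapT => nKO.
have [|F [Q [[uF pF kF nFp mQ] GQ]]] := logic_cover (@extension_logic _ _)
    (@extBD _ _) hn (extA _) admissible_ko _ nKO.
  by apply: logic_ko; [exact: extension_logic|exact: extR].
have [|k Qkp] := sem_PK_complete _ GQ val.
  by move=> k; exact: (max_filter_ko uF pF kF nFp).
exact: nFp (maxf_sub (mQ k) Qkp).
Qed.
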